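(* Let $a\neq 0$ be a real number, let $k\ge 1$ be an integer, let $P_1$ be a real polynomial of degree $k+1$, and write $P_2(x)=P_1(x-1)-P_1(x)$ (so that $P_2$ is a polynomial of degree $k$). Assume that $P_2(-n)\neq 0$ for all $n\ge 0$, and define the sequences of numbers $$\gamma_{n+1}=P_2(-n)\ (n\ge 0),\qquad \lambda_n=P_1(-n)\ (n\ge 0),\qquad \beta_n=\frac{\gamma_{n+1}}{\gamma_n}\ (n\ge 1),$$ and the sequence of polynomials $q_0=1$ and, for $n\ge 1$, $$q_n(x)=c_n^a(x)+\beta_n c_{n-1}^a(x),$$ where $(c_n^a)_n$ are the Charlier polynomials. Let $$D=P_1(D_a)+\nabla P_2(D_a),$$ where $D_a$ is the second order Charlier difference operator. Then $D$ is a difference operator of order $2k+2$ and genre $(-k-1,k+1)$, and $D(q_n)=\lambda_n q_n$ for all $n\ge 0$.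
   Context: For $l\in\mathbb{Z}$ the shift operator $\mathfrak{s}_l$ acts on polynomials by $\mathfrak{s}_l(f)(x)=f(x+l)$, and $\nabla f(x)=f(x)-f(x-1)$. A finite difference operator $\sum_{l=s}^r f_l\,\mathfrak{s}_l$ (with polynomial coefficients $f_l=f_l(x)$, $s\le r$ integers) with $f_s,f_r\neq 0$ has order $r-s$ and genre $(s,r)$. For a linear operator $T$ and a polynomial $P(x)=\sum_j a_jx^j$, $P(T)=\sum_j a_jT^j$; products of operators are compositions. Charlier polynomials ($a\neq 0$): $c_n^a(x)=\frac{1}{n!}\sum_{j=0}^n(-a)^{n-j}\binom{n}{j}\binom{x}{j}j!$. Charlier operator: $D_a=x\,\mathfrak{s}_{-1}-(x+a)\,\mathfrak{s}_0+a\,\mathfrak{s}_1$, which satisfies $D_a(c_n^a)=-n\,c_n^a$. *)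

(* Defs.v *)
From HB Require Import structures.
From mathcomp Require Import all_boot all_order all_algebra.
From mathcomp Require Export reals.

Set Implicit Arguments.
Unset Strict Implicit.
Unset Printing Implicit Defensive.

Import GRing.Theory.
Local Open Scope ring_scope.

Section Operators.
Variable R : comNzRingType.
Implicit Types (l s r : int) (p P : {poly R}) (a : R).

Definition shift l p : {poly R} := p \Po ('X + (l%:~R)%:P).

Fact shift_is_linear l : linear (shift l).
Proof. exact: linearP. Qed.
HB.instance Definition _ l :=
  GRing.isLinear.Build R {poly R} {poly R} _ (shift l) (shift_is_linear l).

Definition nabla p : {poly R} := p - shift (-1) p.

Definition charlier_op a p : {poly R} :=
  'X * shift (-1) p - ('X + a%:P) * shift 0 p + a%:P * shift 1 p.

Fact charlier_op_is_linear a : linear (charlier_op a).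
Proof.
move=> c p q; rewrite /charlier_op !linearP !mulrDr -!scalerAr.
by rewrite scalerDr scalerBr opprD (addrACA (c *: _)); apply: addrACA.
Qed.
HB.instance Definition _ a :=
  GRing.isLinear.Build R {poly R} {poly R} _ (charlier_op a)
    (charlier_op_is_linear a).

(* P(T) = \sum_j P_j T^j; mathcomp has no algebra of endomorphisms of an
   infinite-dimensional module in which to evaluate P with horner_alg. *)
Definition poly_op (V : lmodType R) (P : {poly R}) (T : {linear V -> V})
    (v : V) : V :=
  \sum_(j < size P) P`_j *: iter j T v.

(* The sum over s <= l <= r of f_l s_l is indexed by l = s + i. *)
Definition has_genre (T : {poly R} -> {poly R}) s r : Prop :=
  s <= r /\
  exists f : int -> {poly R},
    [/\ f s != 0, f r != 0 &
        forall p, T p = \sum_(i < `|r - s|%N.+1)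
                          f (s + i%:Z) * shift (s + i%:Z) p].

Definition has_order (T : {poly R} -> {poly R}) (m : int) : Prop :=
  exists s r, has_genre T s r /\ m = r - s.

End Operators.

Section Charlier.
Variable F : fieldType.

Definition binom_poly (j : nat) : {poly F} :=
  (j`!%:R)^-1 *: \prod_(i < j) ('X - (i%:R)%:P).

Definition charlier (a : F) (n : nat) : {poly F} :=
  (n`!%:R)^-1 *:
    \sum_(j < n.+1) ((- a) ^+ (n - j) * 'C(n, j)%:R) *: (j`!%:R *: binom_poly j).

End Charlier.

(* Main.v *)
From HB Require Import structures.
Require Import Defs.
From mathcomp Require Import all_boot all_order all_algebra.
From mathcomp Require Import ring zify.
Set Implicit Arguments.
Unset Strict Implicit.
Unset Printing Implicit Defensive.

Import GRing.Theory Num.Theory.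
Local Open Scope ring_scope.

(** Eigenvalues.  The Charlier polynomials satisfy
    [nabla c_(n+1) = shift (-1) c_n], hence [nabla (c_n + c_(n-1)) = c_(n-1)].
    Since [D_a c_n = - n c_n], a polynomial in [D_a] acts on [c_n] by
    evaluation at [- n], and [beta n * P2(1 - n) = P2(- n)] lets [nabla] be
    applied to a multiple of exactly this sum:
    [[
      D q_n = P1(- n) c_n + beta n P1(1 - n) c_(n-1)
              + P2(- n) nabla (c_n + c_(n-1))
            = P1(- n) c_n + (beta n P1(1 - n) + P2(- n)) c_(n-1).
    ]]
    As [P2(- n) = beta n P2(1 - n) = beta n (P1(- n) - P1(1 - n))], the last
    coefficient is [P1(- n) beta n].

    Genre.  [P1(D_a)] has genre [(-k-1, k+1)] with extreme coefficients
    [p x (x-1) ... (x-k)] and [p a^(k+1)], where [p] is the leading coefficient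
    of [P1].  By Taylor's formula [P2] has degree [k] and leading coefficient
    [- (k+1) p], so [nabla P2(D_a)] reaches the shift [-k-1], with coefficient
    [(k+1) p (x-1) ... (x-k)], but not the shift [k+1].  The extreme
    coefficients of [D] are therefore [p (x+k+1) (x-1) ... (x-k)] and
    [p a^(k+1)].  They are computed in [poly_op_charlier_symbol] and
    [coef_backward_difference]. *)

(** * Shifts and falling factorials *)

Section Shifts.
Variable R : comNzRingType.
Implicit Types (p q : {poly R}) (l m : int).

Lemma shiftM l p q : shift l (p * q) = shift l p * shift l q.
Proof. exact: comp_polyM. Qed.

Lemma shift_comp l m p : shift l (shift m p) = shift (l + m) p.
Proof.
rewrite /shift -comp_polyA; congr (_ \Po _).
by rewrite comp_polyD comp_polyX comp_polyC intrD rmorphD /= addrA.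
Qed.

Lemma shift0 p : shift 0 p = p.
Proof. by rewrite /shift addr0 comp_polyXr. Qed.

Lemma shift_eq0 l p : (shift l p == 0) = (p == 0).
Proof.
apply/eqP/eqP=> [p0 | ->]; last exact: linear0.
by rewrite -(shift0 p) -(addNr l) -shift_comp p0 linear0.
Qed.

Definition fallfac j : {poly R} := \prod_(i < j) ('X - (i%:R)%:P).

Lemma fallfacSr j : fallfac j.+1 = fallfac j * ('X - (j%:R)%:P).
Proof. by rewrite /fallfac big_ord_recr. Qed.

Lemma fallfacSl j : fallfac j.+1 = 'X * shift (-1) (fallfac j).
Proof.
rewrite /fallfac big_ord_recl subr0; congr (_ * _).
rewrite /shift rmorph_prod; apply: eq_bigr => i _.
rewrite lift0 /= comp_polyB comp_polyX comp_polyC -natr1 polyCD.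
by rewrite (_ : (-1)%:~R = -1 :> R) // polyCN; ring.
Qed.

Lemma fallfac_neq0 j : fallfac j != 0.
Proof. by rewrite monic_neq0 // /fallfac monic_prod // => i _; apply: monicXsubC. Qed.

Lemma nabla_fallfac j : nabla (fallfac j.+1) = j.+1%:R *: shift (-1) (fallfac j).
Proof.
rewrite /nabla {1}fallfacSl fallfacSr shiftM.
have ->: shift (-1) ('X - j%:R%:P) = 'X - (j.+1%:R)%:P :> {poly R}.
  rewrite /shift comp_polyB comp_polyX comp_polyC -natr1 polyCD.
  by rewrite (_ : (-1)%:~R = -1 :> R) // polyCN; ring.
by rewrite -mul_polyC; ring.
Qed.

Lemma fallfac0 : fallfac 0 = 1.
Proof. exact: big_ord0. Qed.

Lemma nabla1 : nabla (1 : {poly R}) = 0.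
Proof. by rewrite /nabla /shift -polyC1 comp_polyC subrr. Qed.

Lemma charlier_opE a p :
  charlier_op a p = a%:P * (shift 1 p - p) - 'X * nabla p.
Proof. by rewrite /charlier_op shift0 /nabla; ring. Qed.

Lemma nabla_linear : linear (@nabla R).
Proof.
by move=> c p q; rewrite /nabla linearP scalerBr; rewrite opprD addrACA.
Qed.
HB.instance Definition _ :=
  GRing.isLinear.Build R {poly R} {poly R} _ (@nabla R) nabla_linear.

End Shifts.

(** * Polynomials in a linear operator *)

Section PolyOp.
Variables (R : comNzRingType) (V : lmodType R) (T : {linear V -> V}).
Implicit Types (P : {poly R}) (v : V).

Lemma poly_op_wide P N v : (size P <= N)%N ->
  poly_op P T v = \sum_(j < N) P`_j *: iter j T v.
Proof.
move=> leN; rewrite /poly_op -!(big_mkord xpredT (fun j => P`_j *: iter j T v)).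
rewrite [RHS](big_cat_nat (n := size P)) //= [X in _ = _ + X]big_nat [X in _ = _ + X]big1 ?addr0 //.
by move=> j /andP[/(nth_default 0)-> _]; rewrite scale0r.
Qed.

Lemma poly_op_linear P : linear (poly_op P T).
Proof.
move=> c u v; rewrite /poly_op scaler_sumr -big_split; apply: eq_bigr => j _ /=.
have ->: iter j T (c *: u + v) = c *: iter j T u + iter j T v.
  by elim: (j : nat) => //= i ->; rewrite linearP.
by rewrite scalerDr !scalerA mulrC.
Qed.
HB.instance Definition _ P :=
  GRing.isLinear.Build R V V _ (poly_op P T) (poly_op_linear P).

(** Horner's scheme: this makes statements about [poly_op P T] provable by
    induction on a bound for the degree of [P]. *)
Lemma poly_op_horner P v :
  poly_op P T v = T (poly_op (drop_poly 1 P) T v) + P`_0 *: v.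
Proof.
rewrite (@poly_op_wide P (size P).+1) // big_ord_recl addrC; congr (_ + _).
rewrite (@poly_op_wide _ (size P)) ?size_drop_poly ?leq_subr // linear_sum.
by apply: eq_bigr => j _; rewrite linearZ coef_drop_poly addn1.
Qed.

Lemma poly_op_eigen P (c : R) v : T v = c *: v -> poly_op P T v = P.[c] *: v.
Proof.
move=> Tv; rewrite horner_coef scaler_suml; apply: eq_bigr => j _.
rewrite -scalerA; congr (_ *: _); elim: (j : nat) => [|i IH] /=.
  by rewrite scale1r.
by rewrite IH linearZ /= Tv scalerA exprSr.
Qed.

End PolyOp.

(** * Extreme coefficients of difference operators *)

Section Symbols.
Variable R : comNzRingType.
Implicit Types (G : {poly {poly R}}) (p : {poly R}) (m : nat).

(** A difference operator with shifts [>= - m] is encoded by its symbol, a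
    polynomial [G] over [{poly R}] whose coefficient of degree [i] multiplies
    the shift [i - m]; so [G / Y^m] is a Laurent polynomial in the shift [Y].
    Left composition with shifts becomes multiplication by [Y] twisted by a
    shift of the coefficients. *)
Definition symbol_op m G p : {poly R} :=
  \sum_(i < size G) G`_i * shift (i%:Z - m%:Z) p.

Lemma symbol_op_wide m G p N : (size G <= N)%N ->
  symbol_op m G p = \sum_(i < N) G`_i * shift (i%:Z - m%:Z) p.
Proof.
move=> leN.
rewrite /symbol_op -!(big_mkord xpredT (fun i => G`_i * shift (i%:Z - m%:Z) p)).
rewrite [RHS](big_cat_nat (n := size G)) //= [X in _ = _ + X]big_nat [X in _ = _ + X]big1 ?addr0 //.
by move=> j /andP[/(nth_default 0)-> _]; rewrite mul0r.
Qed.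

Lemma symbol_op_linear m p : linear (symbol_op m ^~ p : {poly {poly R}} -> {poly R}^o).
Proof.
move=> c G H; pose N := maxn (size (c *: G + H)) (maxn (size G) (size H)).
rewrite !(@symbol_op_wide m _ p N) ?leq_max ?leqnn ?orbT //.
rewrite scaler_sumr -big_split; apply: eq_bigr => i _ /=.
by rewrite coefD coefZ mulrDl -mulrA.
Qed.

Lemma symbol_opD m G H p : symbol_op m (G + H) p = symbol_op m G p + symbol_op m H p.
Proof. by have:= symbol_op_linear m p 1 G H; rewrite !scale1r. Qed.

Lemma symbol_opZ m f G p : symbol_op m (f *: G) p = f * symbol_op m G p.
Proof.
have /(_ f G 0):= symbol_op_linear m p; rewrite addr0 => ->.
by rewrite [symbol_op m 0 p]/symbol_op size_poly0 big_ord0 addr0.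
Qed.

Lemma symbol_opMX m G p : symbol_op m.+1 (G * 'X) p = symbol_op m G p.
Proof.
rewrite (@symbol_op_wide m.+1 _ p (size G).+1) ?size_polyMleq //; last first.
  by apply: leq_trans (size_polyMleq _ _) _; rewrite size_polyX addn2.
rewrite big_ord_recl coefMX mul0r add0r; apply: eq_bigr => i _.
by rewrite lift0 coefMX /=; congr (_ * shift _ _); lia.
Qed.

Lemma shift_symbol_op l m G p :
  shift l (symbol_op m G p) = 
  \sum_(i < size G) (map_poly (shift l) G)`_i * shift (l + (i%:Z - m%:Z)) p.
Proof.
rewrite linear_sum; apply: eq_bigr => i _ /=.
by rewrite shiftM shift_comp coef_map.
Qed.

(** Raising the offset from [m] to [m.+1] absorbs the shift by [-1]; a shift by
    [0] then costs a factor ['X], and a shift by [1] a factor ['X^2]. *)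
Lemma shiftN1_symbol_op m G p :
  shift (-1) (symbol_op m G p) = symbol_op m.+1 (map_poly (shift (-1)) G) p.
Proof.
rewrite shift_symbol_op (@symbol_op_wide _ _ _ (size G)) ?size_poly //.
by apply: eq_bigr => i _; congr (_ * shift _ _); lia.
Qed.

Lemma shift1_symbol_op m G p :
  shift 1 (symbol_op m G p) = symbol_op m.+1 (map_poly (shift 1) G * 'X^2) p.
Proof.
rewrite shift_symbol_op.
rewrite expr2 mulrA symbol_opMX (@symbol_op_wide _ _ _ (size G).+1); last first.
  apply: leq_trans (size_polyMleq _ _) _; rewrite size_polyX addn2 ltnS.
  exact: size_poly.
rewrite big_ord_recl coefMX mul0r add0r; apply: eq_bigr => i _.
by rewrite lift0 coefMX /=; congr (_ * shift _ _); lia.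
Qed.

Lemma charlier_symbol a m G p :
  charlier_op a (symbol_op m G p) =
  symbol_op m.+1 ('X *: map_poly (shift (-1)) G + (- ('X + a%:P)) *: (G * 'X)
                  + a%:P *: (map_poly (shift 1) G * 'X^2)) p.
Proof.
rewrite !symbol_opD !symbol_opZ symbol_opMX -shiftN1_symbol_op -shift1_symbol_op.
by rewrite /charlier_op shift0 mulNr.
Qed.

Lemma nabla_symbol m G p :
  nabla (symbol_op m G p) =
  symbol_op m.+1 (G * 'X + (-1) *: map_poly (shift (-1)) G) p.
Proof.
by rewrite symbol_opD symbol_opZ symbol_opMX -shiftN1_symbol_op mulN1r.
Qed.

(** Each composition with [charlier_op a] widens the range of shifts by one on
    both sides.  It multiplies the highest coefficient by [a] and turns the
    lowest one, [f], into ['X * shift (-1) f]; iterating the latter on [1]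
    produces falling factorials. *)
Lemma poly_op_charlier_symbol a m (P : {poly R}) : (size P <= m.+1)%N ->
  exists G, [/\ (size G <= m.*2.+1)%N,
     forall p, poly_op P (charlier_op a) p = symbol_op m G p,
     G`_0 = P`_m *: fallfac R m & G`_m.*2 = (P`_m * a ^+ m)%:P].
Proof.
elim: m P => [|m IH] P leP.
  exists (P`_0)%:P%:P; split.
  - exact: size_polyC_leq1.
  - move=> p; rewrite (@poly_op_wide _ _ _ _ 1) // (@symbol_op_wide _ _ _ 1) ?size_polyC_leq1 //.
    by rewrite !big_ord1 /= coefC /= shift0 mul_polyC.
  - by rewrite coefC /= fallfac0 alg_polyC.
  - by rewrite coefC mulr1.
have [|G [szG eqG lowG highG]] := IH (drop_poly 1 P).
  by rewrite size_drop_poly; lia.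
rewrite coef_drop_poly addn1 in lowG highG.
have G0 j : (m.*2 < j)%N -> G`_j = 0 by move=> ltj; rewrite nth_default ?(leq_trans szG).
(* The symbol is the one that [charlier_symbol] yields from [G], plus the
   constant term of [P], which acts through the shift [0] in position
   [m.+1]. *)
eexists; split; last first; last 2 first.
- move=> p; rewrite poly_op_horner eqG /= charlier_symbol.
  have ->: P`_0 *: p = symbol_op m.+1 ((P`_0)%:P *: 'X^(m.+1)) p.
    rewrite symbol_opZ mul_polyC; congr (_ *: _).
    rewrite /symbol_op size_polyXn big_ord_recr /= coefXn eqxx mul1r subrr shift0.
    by rewrite big1 ?add0r // => i _; rewrite coefXn ltn_eqF ?mul0r.
  by rewrite -symbol_opD.
- apply/leq_sizeP=> j lej.
  rewrite !coefD !coefZ coefMX coefMXn !coef_map /= coefXn.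
  have ->: (j == m.+1) = false by lia.
  rewrite !G0; [ | lia..].
  by rewrite !linear0 !if_same !mulr0 !addr0.
- rewrite !coefD !coefZ coefMX coefMXn !coef_map /= coefXn.
  rewrite (G0 m.+1.*2) ?(G0 m.+1.*2.-1); [ | lia..].
  have ->: (m.+1.*2 == m.+1) = false by lia.
  have ->: (m.+1.*2 - 2 = m.*2)%N by lia.
  rewrite highG /= linear0 !mulr0 !addr0 add0r /shift comp_polyC -polyCM.
  by congr _%:P; rewrite exprS; ring.
- rewrite !coefD !coefZ coefMX coefMXn !coef_map /= coefXn /= !mulr0 !addr0.
  by rewrite lowG linearZ /= -scalerAr -fallfacSl.
Qed.

Lemma symbol_has_genre (T : {poly R} -> {poly R}) m G :
  (size G <= m.*2.+1)%N -> (forall p, T p = symbol_op m G p) ->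
  G`_0 != 0 -> G`_m.*2 != 0 -> has_genre T (- m%:Z) m%:Z.
Proof.
move=> szG eqT low high; split; first by lia.
exists (fun l => G`_(absz (l + m%:Z))); split.
- by rewrite addNr.
- by rewrite (_ : absz _ = m.*2) //; lia.
move=> p; rewrite eqT (@symbol_op_wide _ _ _ m.*2.+1) //.
have ->: absz (m%:Z - - m%:Z) = m.*2 by lia.
apply: eq_bigr => i _; congr (_`_ _ * shift _ _); lia.
Qed.

(** Taylor's formula at ['X] with step [-1]: the term of order [0] cancels [P],
    and of the others only the one of order [1] reaches degree [m]. *)
Lemma coef_backward_difference (P : {poly R}) m : (size P <= m.+2)%N ->
  (size (P \Po ('X - 1%:P) - P)%R <= m.+1)%N /\
  (P \Po ('X - 1%:P) - P)`_m = - (m.+1%:R * P`_m.+1).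
Proof.
move=> szP.
have eqc i : (P \Po ('X - 1%:P) - P)`_i =
    \sum_(j < m.+1) (-1) ^+ j.+1 * (P`_(j.+1 + i) *+ 'C(j.+1 + i, j.+1)).
  rewrite /comp_poly -polyCN.
  rewrite (@nderiv_taylor_wide _ m.+2 _ _ (-1)%:P) ?size_map_polyC //; last exact: mulrC.
  rewrite big_ord_recl expr0 mulr1 nderivn0 [_.['X]](comp_polyXr P) addrC addKr.
  rewrite coef_sum; apply: eq_bigr => j _.
  rewrite lift0 nderivn_map [_.['X]](comp_polyXr P^`N(j.+1)).
  by rewrite -polyC_exp coefMC coef_nderivn mulrC.
have P0 i : (m.+2 <= i)%N -> P`_i = 0 by move=> lei; rewrite nth_default ?(leq_trans szP).
split.
  apply/leq_sizeP=> i ltmi; rewrite eqc big1 // => j _.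
  by rewrite P0 ?mul0rn ?mulr0 //; lia.
rewrite eqc big_ord_recl big1 ?addr0 => [|j _]; last first.
  by rewrite lift0 P0 ?mul0rn ?mulr0 //; lia.
by rewrite expr1 mulN1r add1n bin1 mulr_natl.
Qed.

End Symbols.

(** * Charlier polynomials *)

Section CharlierPolynomials.
Variable R : numFieldType.
Implicit Types (a : R) (n : nat).

(** With respect to falling factorials the coefficient of index [j] is a
    product of a function of [n - j] and one of [j], so that the recurrences of
    [c_n] can be read off coefficientwise. *)
Definition charlier_coef a n j : R := (- a) ^+ (n - j) / ((n - j)`!%:R * j`!%:R).

Lemma natr_fact_neq0 n : n`!%:R != 0 :> R.
Proof. by rewrite pnatr_eq0 -lt0n fact_gt0. Qed.

Lemma charlierE a n : charlier a n = \sum_(j < n.+1) charlier_coef a n j *: fallfac R j.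
Proof.
rewrite /charlier scaler_sumr; apply: eq_bigr => j _.
rewrite /binom_poly !scalerA; congr (_ *: _); rewrite /charlier_coef.
have lejn : (j <= n)%N by rewrite -ltnS.
have /(congr1 (fun m => m%:R : R)) := bin_fact lejn; rewrite !natrM => <-.
have bin_neq0 : 'C(n, j)%:R != 0 :> R by rewrite pnatr_eq0 -lt0n bin_gt0.
have := natr_fact_neq0 j; have := natr_fact_neq0 (n - j) => nj0 j0.
by field; rewrite nj0 j0 bin_neq0.
Qed.

Lemma charlier_coefS a n j :
  charlier_coef a n.+1 j.+1 * j.+1%:R = charlier_coef a n j.
Proof.
rewrite /charlier_coef subSS factS natrM.
have := natr_fact_neq0 j; have := natr_fact_neq0 (n - j) => nj0 j0.
have j1 : j.+1%:R != 0 :> R by rewrite pnatr_eq0.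
by field; rewrite nj0 j0 nat1r j1.
Qed.

Lemma charlier_coef_exponent a n j : (j <= n)%N ->
  charlier_coef a n.+1 j * j%:R = charlier_coef a n.+1 j * n.+1%:R + a * charlier_coef a n j.
Proof.
move=> lejn; rewrite /charlier_coef subSn // factS natrM exprS.
have -> : n.+1%:R = j%:R + (n - j).+1%:R :> R by rewrite -natrD addnS subnKC.
have := natr_fact_neq0 j; have := natr_fact_neq0 (n - j) => nj0 j0.
have j1 : (n - j).+1%:R != 0 :> R by rewrite pnatr_eq0.
by field; rewrite nj0 j0 nat1r j1.
Qed.

(** [nabla] sends [fallfac j.+1] to [j.+1] times the shift by [-1] of
    [fallfac j], and the coefficients compensate the factor [j.+1]. *)
Lemma nabla_charlier a n : nabla (charlier a n.+1) = shift (-1) (charlier a n).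
Proof.
rewrite !charlierE !linear_sum big_ord_recl linearZ /= fallfac0 nabla1 scaler0 add0r.
apply: eq_bigr => j _; rewrite [bump 0 j]add1n !linearZ /= nabla_fallfac scalerA.
by rewrite charlier_coefS.
Qed.

Lemma forward_charlier a n :
  shift 1 (charlier a n.+1) - charlier a n.+1 = charlier a n.
Proof.
have /(congr1 (shift 1)) := nabla_charlier a n.
by rewrite /nabla linearB /= !shift_comp !shift0.
Qed.

(** ['X * nabla] is the Euler operator of the falling factorials: it multiplies
    [fallfac j] by [j].  Writing [j] as [n.+1 - (n.+1 - j)] separates the
    two terms on the right. *)
Lemma mulX_nabla_charlier a n :
  'X * nabla (charlier a n.+1) = n.+1%:R *: charlier a n.+1 + a *: charlier a n.
Proof.
transitivity (\sum_(j < n.+2) (charlier_coef a n.+1 j * j%:R) *: fallfac R j).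
  rewrite nabla_charlier charlierE linear_sum mulr_sumr [RHS]big_ord_recl mulr0 scale0r add0r.
  apply: eq_bigr => j _; rewrite lift0 charlier_coefS /= linearZ /= -scalerAr.
  by rewrite -fallfacSl.
rewrite !charlierE big_ord_recr [X in _ *: X + _]big_ord_recr /=.
rewrite scalerDr !scaler_sumr addrAC -big_split /=; congr (_ + _).
  apply: eq_bigr => j _; rewrite !scalerA -scalerDl charlier_coef_exponent; last by rewrite -ltnS.
  by rewrite [n.+1%:R * _]mulrC.
by rewrite scalerA mulrC.
Qed.

Lemma charlier0 a : charlier a 0 = 1.
Proof.
by rewrite charlierE big_ord1 /charlier_coef fallfac0 !fact0 !mulr1 divr1 scale1r.
Qed.

(** In [charlier_op a = a (shift 1 - 1) - 'X * nabla], the multiples of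
    [charlier a n.-1] coming from the two summands cancel. *)
Lemma charlier_op_charlier a n : charlier_op a (charlier a n) = - n%:R *: charlier a n.
Proof.
case: n => [|n]; rewrite charlier_opE.
  by rewrite charlier0 /nabla /shift !comp_polyC !subrr !mulr0 subrr oppr0 scale0r.
rewrite forward_charlier mulX_nabla_charlier mul_polyC scaleNr.
by rewrite opprD addrCA subrr addr0.
Qed.

Lemma nabla_charlierD a n : nabla (charlier a n.+1 + charlier a n) = charlier a n.
Proof. by rewrite linearD /= nabla_charlier /nabla addrCA subrr addr0. Qed.

End CharlierPolynomials.

Theorem theorem1p1 (R : realType) (a : R) (k : nat) (P1 P2 : {poly R})
    (gamma lambda beta : nat -> R) (q : nat -> {poly R})
    (D : {poly R} -> {poly R})
    (a_neq0 : a != 0)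
    (k_ge1 : (1 <= k)%N)
    (degP1 : size P1 = k.+2)
    (defP2 : P2 = (P1 \Po ('X - 1%:P)) - P1)
    (P2_neq0 : forall n : nat, P2.[- n%:R] != 0)
    (defgamma : forall n : nat, gamma n.+1 = P2.[- n%:R])
    (deflambda : forall n : nat, lambda n = P1.[- n%:R])
    (defbeta : forall n : nat, (1 <= n)%N -> beta n = gamma n.+1 / gamma n)
    (defq0 : q 0%N = 1)
    (defq : forall n : nat, (1 <= n)%N ->
       q n = charlier a n + beta n *: charlier a n.-1)
    (defD : D = poly_op P1 (charlier_op a)
                \+ (@nabla R \o poly_op P2 (charlier_op a))) :
  [/\ has_order D (2 * k + 2)%N%:Z,
      has_genre D (- (k.+1)%:Z) (k.+1)%:Z &
      forall n : nat, D (q n) = lambda n *: q n].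
Proof.
have lead_neq0 : P1`_k.+1 != 0.
  by rewrite -[k.+1]/(k.+2.-1) -degP1 -lead_coefE lead_coef_eq0 -size_poly_gt0 degP1.
have genreD : has_genre D (- (k.+1)%:Z) (k.+1)%:Z.
  have [szP2 leadP2] := @coef_backward_difference _ P1 k (eq_leq degP1).
  rewrite -defP2 in szP2 leadP2.
  have [G1 [szG1 eqG1 low1 high1]] := poly_op_charlier_symbol a (eq_leq degP1).
  have [G2 [szG2 eqG2 low2 high2]] := poly_op_charlier_symbol a szP2.
  have G20 j : (k.*2 < j)%N -> G2`_j = 0.
    by move=> ltj; rewrite nth_default ?(leq_trans szG2).
  (* Both summands of [D] are written with the same offset [k.+1]. *)
  apply: (@symbol_has_genre _ _ _
    (G1 + (G2 * 'X + (-1) *: map_poly (shift (-1)) G2))).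
  - apply/leq_sizeP=> j lej.
    rewrite !coefD coefZ coefMX coef_map /= !G20; [ | lia..].
    by rewrite nth_default ?(leq_trans szG1) // linear0 if_same mulr0 !addr0.
  - by move=> p; rewrite symbol_opD defD /= eqG1 eqG2 nabla_symbol.
  - rewrite !coefD coefZ coefMX coef_map /= add0r low1 low2 leadP2 linearZ /=.
    have -> : P1`_k.+1 *: fallfac R k.+1
        + -1 * (- (k.+1%:R * P1`_k.+1) *: shift (-1) (fallfac R k))
      = P1`_k.+1 *: (('X + k.+1%:R%:P) * shift (-1) (fallfac R k)).
      by rewrite fallfacSl -!mul_polyC polyCN polyCM; ring.
    rewrite scaler_eq0 negb_or lead_neq0 mulf_neq0 //.
      by rewrite -size_poly_gt0 size_XaddC.
    by rewrite shift_eq0 fallfac_neq0.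
  - rewrite !coefD coefZ coefMX coef_map /= !G20; [ | lia..].
    by rewrite high1 linear0 mulr0 !addr0 polyC_eq0 mulf_neq0 // expf_neq0.
split=> //.
  by exists (- (k.+1)%:Z), (k.+1)%:Z; split => //; lia.
have evalP P n : poly_op P (charlier_op a) (charlier a n) = P.[- n%:R] *: charlier a n.
  exact/poly_op_eigen/charlier_op_charlier.
rewrite defD; case=> [|n].
  by rewrite defq0 -(charlier0 a) /= !evalP deflambda charlier0 [nabla _]linearZ /=
             nabla1 scaler0 addr0.
have betaP2 : beta n.+1 * P2.[- n%:R] = P2.[- n.+1%:R].
  by rewrite defbeta // !defgamma divfK.
have P2diff : P2.[- n%:R] = P1.[- n.+1%:R] - P1.[- n%:R].
  rewrite defP2 !hornerE horner_comp !hornerE; congr (P1.[_] - _).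
  by rewrite -natr1 opprD.
rewrite defq // deflambda /=.
have ev1 P := evalP P n.+1; have ev0 P := evalP P n.
move: (charlier a n.+1) (charlier a n) ev1 ev0 (nabla_charlierD a n).
move=> c1 c0 ev1 ev0 nabla_c10.
have opq P : poly_op P (charlier_op a) (c1 + beta n.+1 *: c0)
    = P.[- n.+1%:R] *: c1 + (beta n.+1 * P.[- n%:R]) *: c0.
  by rewrite linearD [X in _ + X]linearZ /= ev1 ev0 scalerA.
rewrite !opq betaP2 -scalerDr [nabla _]linearZ /= nabla_c10.
rewrite -addrA -scalerDl scalerDr scalerA.
congr (_ + _ *: _); rewrite -betaP2 P2diff; ring.
Qed.
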